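(* Let $X$ be a smooth complex projective curve of genus $2$ with hyperelliptic involution $\iota$. Given a class $[\rho]\in\mathrm{Hom}(\pi_1(X),\mathrm{SL}_2(\mathbb{C}))/\mathrm{PGL}_2(\mathbb{C})$, the following properties are equivalent: (a) $[\rho]$ is either irreducible or abelian; (b) $[\rho]$ is $\iota$-invariant; (c) $[\rho]$ is in the image of $\Phi^{\mathrm{top}}$. If these properties are satisfied, then $[\rho]$ has $1$ or $2$ preimages under $\Phi^{\mathrm{top}}$, depending on whether it is diagonal or not (one preimage if it is diagonal, two otherwise).
   Context: $\mathrm{PGL}_2(\mathbb{C})$ acts by conjugation. $\rho$ is abelian if its image is an abelian group, diagonal if it is conjugate to a representation by diagonal matrices. Let $\pi:X\to X/\iota=\mathbb{P}^1$ be the hyperelliptic cover, with six branch points. The orbifold fundamental group of $X/\iota$ is $$\pi_1^{\mathrm{orb}}(X/\iota)=\langle\gamma_0,\gamma_1,\gamma_r,\gamma_s,\gamma_t,\gamma_\infty\mid\gamma_0^2=\gamma_1^2=\gamma_r^2=\gamma_s^2=\gamma_t^2=\gamma_\infty^2=1,\ \gamma_0\gamma_1\gamma_r\gamma_s\gamma_t\gamma_\infty=1\rangle,$$ where the $\gamma_i$ are simple loops around the branch points. The map $\pi$ induces a monomorphism $\pi_*:\pi_1(X)\hookrightarrow\pi_1^{\mathrm{orb}}(X/\iota)$ whose image is the index $2$ subgroup of words of even length in the $\gamma_i$; conjugation by any $\gamma_i$ induces on $\pi_1(X)$ the outer automorphism given by $\iota$. $[\rho]$ is $\iota$-invariant if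 it is fixed by this outer action. $\mathrm{Hom}(\pi_1^{\mathrm{orb}}(X/\iota),\mathrm{GL}_2)$ denotes here the set of representations such that each $\gamma_i$ is sent to a matrix with eigenvalues $1$ and $-1$. The map $\Phi^{\mathrm{top}}:\mathrm{Hom}(\pi_1^{\mathrm{orb}}(X/\iota),\mathrm{GL}_2)/\mathrm{PGL}_2\to\mathrm{Hom}(\pi_1(X),\mathrm{SL}_2)/\mathrm{PGL}_2$ is $[\rho]\mapsto[\rho\circ\pi_*]$. *)

(* Defs.v *)
From mathcomp Require Import all_boot all_order all_algebra.
From mathcomp Require Import complex.
From mathcomp Require Import boolp classical_sets functions cardinality reals.

Set Implicit Arguments.
Unset Strict Implicit.
Unset Printing Implicit Defensive.

Import GRing.Theory.

Local Open Scope classical_set_scope.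
Local Open Scope ring_scope.

(* The six generators gamma_0, gamma_1, gamma_r, gamma_s, gamma_t, gamma_oo are
   indexed, in this order, by 0, ..., 5 : 'I_6. *)
Definition orbifold_relations (H : groupType) (h : 'I_6 -> H) : Prop :=
  (forall i, h i ^+ 2 = 1)%g /\ (\prod_(i < 6) h i = 1)%g.

(* "H is presented by the generators gamma and the relations above", as the
   universal property of a presentation. *)
Definition orbifold_presentation (Gorb : groupType) (gamma : 'I_6 -> Gorb) : Prop :=
  orbifold_relations gamma /\
  forall (H : groupType) (h : 'I_6 -> H), orbifold_relations h ->
    exists! f : Gorb -> H, monoid.monoid_morphism f /\ forall i, f (gamma i) = h i.

(* Since gamma_i^-1 = gamma_i, words in the gamma_i need no inverses. *)
Definition even_words (Gorb : groupType) (gamma : 'I_6 -> Gorb) : set Gorb :=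
  [set x | exists2 w : seq 'I_6, ~~ odd (size w) & x = (\prod_(i <- w) gamma i)%g].

Section Representations.
Variables (R : realType) (G : groupType).
Local Notation M2 := 'M[R[i]]_2.
Implicit Types rho : G -> M2.

(* This forces every rho x to be invertible. *)
Definition is_rep rho : Prop :=
  rho 1%g = 1%:M /\ forall x y : G, rho (x * y)%g = rho x *m rho y.

Definition HomSL2 : set (G -> M2) :=
  [set rho | is_rep rho /\ forall x, \det (rho x) = 1].

(* Conjugation by a class in PGL_2 is conjugation by any of its representatives
   in GL_2. *)
Definition conjugate rho rho' : Prop :=
  exists2 P : M2, P \in unitmx & forall x, rho' x = P *m rho x *m invmx P.

Definition PGL2_class rho : set (G -> M2) := [set rho' | conjugate rho rho'].

Definition mod_PGL2 (A : set (G -> M2)) : set (set (G -> M2)) := PGL2_class @` A.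

Definition irreducible_rep rho : Prop :=
  forall V : {vspace 'cV[R[i]]_2},
    (forall x v, v \in V -> rho x *m v \in V) -> V = 0%VS \/ V = fullv.

Definition abelian_rep rho : Prop :=
  forall x y, rho x *m rho y = rho y *m rho x.

Definition diagonal_rep rho : Prop :=
  exists2 rho', conjugate rho rho' & forall x, is_diag_mx (rho' x).

End Representations.

(* In size 2, having both eigenvalues 1 and -1 determines the spectrum. *)
Definition HomGL2_orb (R : realType) (Gorb : groupType) (gamma : 'I_6 -> Gorb) :
    set (Gorb -> 'M[R[i]]_2) :=
  [set rho | is_rep rho /\
    forall i, eigenvalue (rho (gamma i)) 1 /\ eigenvalue (rho (gamma i)) (-1)].

(* [rho] |-> [rho o pi_*]: all the rho in a class c give the same
   PGL2_class (rho \o pi_star), so the union is that single class. *)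
Definition PhiTop (R : realType) (G Gorb : groupType) (pi_star : G -> Gorb)
    (c : set (Gorb -> 'M[R[i]]_2)) : set (G -> 'M[R[i]]_2) :=
  \bigcup_(rho in c) PGL2_class (rho \o pi_star).

Definition PhiTop_preimages (R : realType) (G Gorb : groupType)
    (gamma : 'I_6 -> Gorb) (pi_star : G -> Gorb) (rho : G -> 'M[R[i]]_2) :
    set (set (Gorb -> 'M[R[i]]_2)) :=
  [set c | mod_PGL2 (HomGL2_orb (R := R) gamma) c /\
           PhiTop pi_star c = PGL2_class rho].

(* Main.v *)
(* The even words are generated by the lifts a_j of gamma_0 gamma_j, which conjugation by
   gamma_0 inverts.  For matrices of determinant 1, a traceless M satisfies
   M A = A^-1 M if and only if tr (M A) = 0, so that the extensions of rho to the orbifold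
   group correspond to the M with tr M = 0, det M = -1 and tr (M rho(a_j)) = 0 for all j,
   through gamma_j |-> M rho(a_j).

   Existence.  The surface relation forces 1, rho(a_1), ..., rho(a_5) to span a proper
   subspace of the 2 x 2 matrices, hence there is a nonzero M orthogonal to all of them for
   the trace form; its kernel is invariant under rho, so M is invertible if rho is
   irreducible.  If rho is abelian, its image spans a space of dimension at most 2, and the
   orthogonal complement contains an invertible matrix.

   If rho is reducible and iota-invariant, an invariant line carries a character chi
   with chi o iota = chi^-1, and invariance yields a second line with character chi^-1:
   either the two lines differ and rho is diagonal, or chi^2 = 1 and rho is, up to
   signs, unipotent.

   Counting.  For two such matrices M and M', Q = 1 + M'M and Q' = 1 - M'M commute with rho,
   satisfy Q M = M' Q and Q' M = - M' Q', and one of them is invertible since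
   det Q + det Q' = 4.  So M and -M represent all preimages, and they are conjugate
   under the centralizer of rho exactly when this centralizer contains an invertible
   traceless matrix anticommuting with M, that is, when rho is diagonal. *)
Require Import Defs.
From HB Require Import structures.
From mathcomp Require Import all_boot all_order all_algebra.
From mathcomp Require Import complex ring.
From mathcomp Require Import boolp classical_sets functions cardinality reals.

Set Implicit Arguments.
Unset Strict Implicit.
Unset Printing Implicit Defensive.

Import GRing.Theory Num.Theory.

Local Open Scope classical_set_scope.
Local Open Scope card_scope.
Local Open Scope ring_scope.

(** * Two by two matrices *)

Section TwoByTwo.
Variable F : numClosedFieldType.
Implicit Types A B M N Q X Y : 'M[F]_2.
Implicit Types v w : 'cV[F]_2.

(** * Entrywise computation *)

Lemma sum2E (f : 'I_2 -> F) : \sum_i f i = f 0 + f 1.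
Proof.
by rewrite !big_ord_recl big_ord0 addr0; congr (_ + f _); apply: val_inj.
Qed.

Lemma mulmx2E m n (A : 'M[F]_(m, 2)) (B : 'M[F]_(2, n)) i j :
  (A *m B) i j = A i 0 * B 0 j + A i 1 * B 1 j.
Proof. by rewrite mxE sum2E. Qed.

Lemma mxtrace2E A : \tr A = A 0 0 + A 1 1.
Proof. by rewrite /mxtrace sum2E. Qed.

Lemma det2E A : \det A = A 0 0 * A 1 1 - A 0 1 * A 1 0.
Proof.
have l0 : lift 0 0 = 1 :> 'I_2 by apply: val_inj.
have l1 : lift 1 0 = 0 :> 'I_2 by apply: val_inj.
rewrite (expand_det_row A 0) sum2E /cofactor !det_mx11 !mxE l0 l1 /=.
by rewrite expr0 expr1 mul1r mulN1r mulrN.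
Qed.

Lemma mx2P A B :
  A 0 0 = B 0 0 -> A 0 1 = B 0 1 -> A 1 0 = B 1 0 -> A 1 1 = B 1 1 -> A = B.
Proof.
have I2 (i : 'I_2) : i = 0 \/ i = 1.
  by case: i => [[|[|//]] ?]; [left | right]; apply: val_inj.
by move=> *; apply/matrixP => i j; case: (I2 i) => ->; case: (I2 j) => ->.
Qed.

Lemma cV2P (u v : 'cV[F]_2) : u 0 0 = v 0 0 -> u 1 0 = v 1 0 -> u = v.
Proof.
move=> u0 u1; apply/matrixP => i j; rewrite ord1.
by case: i => [[|[|//]] ?]; [move: u0 | move: u1]; congr (u _ _ = v _ _); apply: val_inj.
Qed.

Definition mx22 (a b c d : F) : 'M[F]_2 :=
  \matrix_(i, j) if i == 0 then (if j == 0 then a else b)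
                 else (if j == 0 then c else d).

Lemma mx22E a b c d :
  ((mx22 a b c d 0 0 = a) * (mx22 a b c d 0 1 = b)
  * (mx22 a b c d 1 0 = c) * (mx22 a b c d 1 1 = d))%type.
Proof. by rewrite !mxE. Qed.

Lemma scalar2E a : (((a%:M : 'M[F]_2) 0 0 = a) * ((a%:M : 'M[F]_2) 0 1 = 0)
  * ((a%:M : 'M[F]_2) 1 0 = 0) * ((a%:M : 'M[F]_2) 1 1 = a))%type.
Proof. by rewrite !mxE. Qed.

Lemma addmxE m n (A B : 'M[F]_(m, n)) i j : (A + B) i j = A i j + B i j.
Proof. by rewrite mxE. Qed.

Lemma oppmxE m n (A : 'M[F]_(m, n)) i j : (- A) i j = - A i j.
Proof. by rewrite mxE. Qed.

Lemma scalemxE m n a (A : 'M[F]_(m, n)) i j : (a *: A) i j = a * A i j.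
Proof. by rewrite mxE. Qed.

Lemma zeromxE m n i j : (0 : 'M[F]_(m, n)) i j = 0.
Proof. by rewrite mxE. Qed.

(** Rewriting with this turns traces, determinants and products into polynomials in the entries,
    ready for [ring]. *)
Definition mx2E := (mxtrace2E, det2E, mulmx2E, mx22E, scalar2E,
  addmxE, oppmxE, scalemxE, zeromxE).

(** Reduces the use of an equation [a = b] to a [ring] identity, [k] being the multiplier of that
    equation. *)
Lemma lincomb (k a b x y : F) : a = b -> x - y = k * (a - b) -> x = y.
Proof. by move=> ->; rewrite subrr mulr0 => /subr0_eq. Qed.
Arguments lincomb k {a b x y}.

(** * Adjugates and traceless matrices *)

Lemma adj2E A : \adj A = (\tr A)%:M - A.
Proof.
have l0 : lift 0 0 = 1 :> 'I_2 by apply: val_inj.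
have l1 : lift 1 0 = 0 :> 'I_2 by apply: val_inj.
by apply: mx2P; rewrite mxE /cofactor det_mx11 !mxE ?l0 ?l1 mxtrace2E /=; ring.
Qed.

Lemma traceless_sqr N : \tr N = 0 -> N *m N = (- \det N)%:M.
Proof.
rewrite mxtrace2E => /eqP; rewrite addr_eq0 => /eqP N00.
by apply: mx2P; rewrite !mx2E N00; ring.
Qed.

Lemma involution_traceless N : \tr N = 0 -> \det N = -1 -> N *m N = 1%:M.
Proof. by move=> /traceless_sqr -> ->; rewrite opprK. Qed.

(** * Orthogonality for the trace form *)

Lemma traceless_nonisotropic A :
  exists M, [/\ \det M != 0, \tr M = 0 & \tr (M *m A) = 0].
Proof.
(* The traceless matrices orthogonal to [A] form a space of dimension at least 2, while [\det] is a
   nondegenerate quadratic form on the 3-dimensional space of traceless matrices, so it cannot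
   vanish there identically. *)
have [b0|b0] := eqVneq (A 0 1) 0; first have [c0|c0] := eqVneq (A 1 0) 0.
- exists (mx22 0 1 1 0); split; rewrite !mx2E ?b0 ?c0; try ring.
  by rewrite mulr0 mulr1 sub0r oppr_eq0 oner_neq0.
- exists (mx22 1 (- (A 0 0 - A 1 1) / A 1 0) 0 (- 1)); split; rewrite !mx2E; try (by field).
  by rewrite mulr0 subr0 mulrN1 oppr_eq0 oner_neq0.
- exists (mx22 1 0 (- (A 0 0 - A 1 1) / A 0 1) (- 1)); split; rewrite !mx2E; try (by field).
  by rewrite mul0r subr0 mulrN1 oppr_eq0 oner_neq0.
Qed.

(** The centralizer of a non-scalar 2 x 2 matrix [A] consists of the polynomials in [A]. *)
Lemma commuting_span A B : A *m B = B *m A ->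
  (exists s, A = s%:M) \/ exists x c, B = x%:M + c *: A.
Proof.
move=> /matrixP AB.
have := AB 0 0; have := AB 0 1; have := AB 1 0; rewrite !mx2E.
move=> E10 E01 E00.
have [b0|b0] := eqVneq (A 0 1) 0; first have [c0|c0] := eqVneq (A 1 0) 0.
- have [d0|d0] := eqVneq (A 0 0) (A 1 1).
    by left; exists (A 0 0); apply: mx2P; rewrite !mx2E.
  right; pose c := (B 0 0 - B 1 1) / (A 0 0 - A 1 1).
  have dn0 : A 0 0 - A 1 1 != 0 by rewrite subr_eq0.
  exists (B 0 0 - c * A 0 0), c; rewrite /c.
  apply: mx2P; rewrite !mx2E ?b0 ?c0; try by field.
    by apply: (lincomb (A 0 0 - A 1 1)^-1 E01); rewrite b0; field.
  by apply: (lincomb (A 1 1 - A 0 0)^-1 E10); rewrite c0; field; rewrite dn0 -oppr_eq0 opprB dn0.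
- right; pose c := B 1 0 / A 1 0.
  exists (B 0 0 - c * A 0 0), c; rewrite /c.
  apply: mx2P; rewrite !mx2E; try by field.
    by apply: (lincomb (- (A 1 0)^-1) E00); field.
  by apply: (lincomb (- (A 1 0)^-1) E10); field.
- right; pose c := B 0 1 / A 0 1.
  exists (B 0 0 - c * A 0 0), c; rewrite /c.
  apply: mx2P; rewrite !mx2E; try by field.
    by apply: (lincomb ((A 0 1)^-1) E00); field.
  by apply: (lincomb ((A 0 1)^-1) E01); field.
Qed.

Lemma trace_mulmx_scalar M s : \tr M = 0 -> \tr (M *m s%:M) = 0.
Proof. by move=> M0; rewrite mul_mx_scalar mxtraceZ M0 mulr0. Qed.

Lemma trace_mulmx_span M A x c : \tr M = 0 -> \tr (M *m A) = 0 ->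
  \tr (M *m (x%:M + c *: A)) = 0.
Proof.
move=> M0 MA.
by rewrite mulmxDr -scalemxAr mxtraceD mxtraceZ MA trace_mulmx_scalar // mulr0 addr0.
Qed.

Lemma trace_orthogonal1 A :
  exists M, [/\ M != 0, \tr M = 0 & \tr (M *m A) = 0].
Proof.
have [M [dM M0 MA]] := traceless_nonisotropic A; exists M; split => //.
by apply: contraNneq dM => ->; rewrite det0.
Qed.

(** The commutator of [A] and [B] is orthogonal to 1, [A] and [B]; if it vanishes, one of the
    conditions is redundant. *)
Lemma trace_orthogonal2 A B :
  exists M, [/\ M != 0, \tr M = 0, \tr (M *m A) = 0 & \tr (M *m B) = 0].
Proof.
have [AB|AB] := eqVneq (A *m B) (B *m A); last first.
  exists (A *m B - B *m A); split; first by rewrite subr_eq0.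
  - by rewrite !mx2E; ring.
  - by rewrite !mx2E; ring.
  - by rewrite !mx2E; ring.
case: (commuting_span AB) => [[s ->]|[x [c ->]]].
  have [M [? ? ?]] := trace_orthogonal1 B.
  by exists M; split => //; apply: trace_mulmx_scalar.
have [M [? ? ?]] := trace_orthogonal1 A.
by exists M; split => //; apply: trace_mulmx_span.
Qed.

(** The hypothesis says that the commutator of [A] and [B] is orthogonal to [C] as well. *)
Lemma trace_orthogonal3 A B C : \tr (A *m B *m C) = \tr (C *m B *m A) ->
  exists M, [/\ M != 0, \tr M = 0, \tr (M *m A) = 0, \tr (M *m B) = 0
              & \tr (M *m C) = 0].
Proof.
move=> trABC; have [AB|AB] := eqVneq (A *m B) (B *m A); last first.
  exists (A *m B - B *m A); split; first by rewrite subr_eq0.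
  - by rewrite !mx2E; ring.
  - by rewrite !mx2E; ring.
  - by rewrite !mx2E; ring.
  - rewrite mulmxBl mxtraceD trABC raddfN /= [\tr (_ *m A *m C)]mxtrace_mulC mulmxA.
    by rewrite subrr.
case: (commuting_span AB) => [[s ->]|[x [c ->]]].
  have [M [? ? ? ?]] := trace_orthogonal2 B C.
  by exists M; split => //; apply: trace_mulmx_scalar.
have [M [? ? ? ?]] := trace_orthogonal2 A C.
by exists M; split => //; apply: trace_mulmx_span.
Qed.

Lemma adj2_mulV A : \det A = 1 -> \adj A *m A = 1%:M.
Proof. by move=> dA; rewrite mul_adj_mx dA. Qed.

Lemma adj2_mulK A : \det A = 1 -> A *m \adj A = 1%:M.
Proof. by move=> dA; rewrite mul_mx_adj dA. Qed.

(* [\tr (X *m Y *m Z) - \tr (Z *m Y *m X)] is an alternating form in the traceless parts;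
   the proof shows that it vanishes on enough triples of the [Ai]. *)
Lemma trace_orthogonal4 A1 A2 A3 A4 :
    \det A1 = 1 -> \det A2 = 1 -> \det A3 = 1 -> \det A4 = 1 ->
    A4 *m \adj A3 *m A2 *m \adj A1 = \adj A1 *m A2 *m \adj A3 *m A4 ->
  exists M, [/\ M != 0, \tr M = 0, \tr (M *m A1) = 0, \tr (M *m A2) = 0
              & \tr (M *m A3) = 0 /\ \tr (M *m A4) = 0].
Proof.
move=> d1 d2 d3 d4 rel.
(* Multiplying the relation by [A1] cancels [\adj A1] under the trace; replacing [\adj A3] by
   [(\tr A3)%:M - A3] then only changes a sign. *)
have D432 : \tr (A4 *m A3 *m A2) = \tr (A2 *m A3 *m A4).
  have: \tr (A4 *m \adj A3 *m A2) = \tr (A2 *m \adj A3 *m A4).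
    have := congr1 (fun X => \tr (X *m A1)) rel.
    rewrite -[_ *m \adj A1 *m A1]mulmxA adj2_mulV // mulmx1 => ->.
    by rewrite mxtrace_mulC !mulmxA adj2_mulK // mul1mx.
  by move/(lincomb (- 1)); apply; rewrite !adj2E !mx2E; ring.
have D321 : \tr (A3 *m A2 *m A1) = \tr (A1 *m A2 *m A3).
  have: \tr (\adj A3 *m A2 *m \adj A1) = \tr (\adj A1 *m A2 *m \adj A3).
    have := congr1 (fun X => \tr (\adj A4 *m X)) rel.
    rewrite !mulmxA adj2_mulV // mul1mx => ->.
    by rewrite mxtrace_mulC !mulmxA adj2_mulK // mul1mx.
  by move/(lincomb 1); apply; rewrite !adj2E !mx2E; ring.
have [C23|C23] := eqVneq (A2 *m A3) (A3 *m A2); last first.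
  exists (A2 *m A3 - A3 *m A2); split; first by rewrite subr_eq0.
  - by rewrite !mx2E; ring.
  - rewrite mulmxBl raddfB /= [\tr (A3 *m A2 *m A1)]D321.
    by rewrite [X in X - _]mxtrace_mulC !mulmxA subrr.
  - by rewrite !mx2E; ring.
  - split; first by rewrite !mx2E; ring.
    rewrite mulmxBl raddfB /= -D432 [X in _ - X]mxtrace_mulC.
    by rewrite !mulmxA subrr.
(* This is the trace of the relation itself, with both adjugates expanded. *)
have D421 : \tr A2 * (\tr (A4 *m A3 *m A1) - \tr (A1 *m A3 *m A4))
          = \tr A3 * (\tr (A4 *m A2 *m A1) - \tr (A1 *m A2 *m A4)).
  have trrel := congr1 (@mxtrace F 2) rel.
  apply/subr0_eq.
  have -> : \tr A2 * (\tr (A4 *m A3 *m A1) - \tr (A1 *m A3 *m A4))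
          - \tr A3 * (\tr (A4 *m A2 *m A1) - \tr (A1 *m A2 *m A4))
    = 2 * (\tr (A4 *m \adj A3 *m A2 *m \adj A1) - \tr (\adj A1 *m A2 *m \adj A3 *m A4))
     + \tr A1 * (\tr (A4 *m A3 *m A2) - \tr (A2 *m A3 *m A4))
     - \tr A4 * (\tr (A3 *m A2 *m A1) - \tr (A1 *m A2 *m A3)).
    by rewrite !adj2E !mx2E; ring.
  by rewrite trrel D432 D321 !subrr !mulr0 addr0 subr0.
case: (commuting_span (esym C23)) => [[s A3s]|[x [c A2xc]]].
  have [|M [? ? ? ? ?]] := @trace_orthogonal3 A1 A2 A4.
    move: D421; rewrite A3s !mul_mx_scalar -!scalemxAl !mxtraceZ [\tr (A4 *m A1)]mxtrace_mulC.
    rewrite subrr mulr0 => /esym/eqP; rewrite mulf_eq0 subr_eq0 => /orP[|/eqP//].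
    move: d3; rewrite mxtrace_scalar A3s det_scalar => s2.
    rewrite mulrn_eq0 /= => /eqP s0; move: s2; rewrite s0 expr0n /= => /eqP.
    by rewrite eq_sym oner_eq0.
  by exists M; split => //; split => //; rewrite A3s; apply: trace_mulmx_scalar.
have [D431|D431] := eqVneq (\tr (A4 *m A3 *m A1)) (\tr (A1 *m A3 *m A4)).
  have [M [? ? ? ? ?]] := trace_orthogonal3 (esym D431).
  by exists M; split => //; rewrite A2xc; apply: trace_mulmx_span.
have D421c : \tr (A4 *m A2 *m A1) - \tr (A1 *m A2 *m A4)
           = c * (\tr (A4 *m A3 *m A1) - \tr (A1 *m A3 *m A4)).
  by rewrite A2xc !mx2E; ring.
(* In the remaining case [D421] forces [x = 0], so [A2] is a multiple of [A3]. The relation then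
   makes [A4] and [A1] commute, against [D431]. *)
rewrite -subr_eq0 in D431; exfalso.
have x0 : x = 0.
  move: D421; rewrite D421c mulrA => /(mulIf D431).
  rewrite A2xc mxtraceD mxtraceZ mxtrace_scalar => /eqP.
  by rewrite mulrC -subr_eq0 [\tr A3 * c]mulrC addrK mulrn_eq0 => /eqP.
have cn0 : c != 0.
  apply/eqP => c0; move: d2; rewrite A2xc x0 c0 scale0r raddf0 addr0 det0 => /esym/eqP.
  by rewrite oner_eq0.
move: A2xc; rewrite x0 raddf0 add0r => A2c.
have C41 : A4 *m \adj A1 = \adj A1 *m A4.
  move: rel; rewrite A2c -!scalemxAr -!scalemxAl.
  rewrite -[A4 *m _ *m A3]mulmxA adj2_mulV // mulmx1 -[\adj A1 *m A3 *m _]mulmxA.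
  rewrite adj2_mulK // mulmx1 => /(congr1 (fun X => c^-1 *: X)).
  by rewrite !scalerA mulVf // !scale1r.
have {}C41 : A4 *m A1 = A1 *m A4.
  by apply: (@oppr_inj 'M[F]_2); apply: (@addrI 'M[F]_2 (\tr A1 *: A4));
     move: C41; rewrite adj2E mulmxBr mulmxBl mul_mx_scalar mul_scalar_mx.
move/eqP: D431; apply; rewrite [\tr (A4 *m A3 *m A1)]mxtrace_mulC.
by rewrite [\tr (_ *m A3 *m A4)]mxtrace_mulC !mulmxA C41 subrr.
Qed.

(** * Eigenvectors and spectra *)

Lemma cV2_neq0 v : v != 0 -> v 0 0 != 0 \/ v 1 0 != 0.
Proof.
move=> v0; have [e0|] := eqVneq (v 0 0) 0; last by left.
have [e1|] := eqVneq (v 1 0) 0; last by right.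
by case/eqP: v0; apply: cV2P; rewrite zeromxE.
Qed.

Lemma eq_on_basis v w X Y : v != 0 -> (forall k, w != k *: v) ->
  X *m v = Y *m v -> X *m w = Y *m w -> X = Y.
Proof.
move=> v0 wv Xv Xw.
(* The determinant of the basis [v], [w]; the entries of [X - Y] vanish by Cramer's rule. *)
have d0 : v 0 0 * w 1 0 - v 1 0 * w 0 0 != 0.
  apply/eqP => d0; case: (cV2_neq0 v0) => vi.
    case/eqP: (wv (w 0 0 / v 0 0)); apply: cV2P; rewrite scalemxE ?divfK //.
    by apply: (lincomb (v 0 0)^-1 d0); field.
  case/eqP: (wv (w 1 0 / v 1 0)); apply: cV2P; rewrite scalemxE ?divfK //.
  by apply: (lincomb (- (v 1 0)^-1) d0); field.
have entry i j : (X - Y) i j = 0.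
  have Ev : (X - Y) i 0 * v 0 0 + (X - Y) i 1 * v 1 0 = 0.
    by rewrite -mulmx2E mulmxBl Xv subrr zeromxE.
  have Ew : (X - Y) i 0 * w 0 0 + (X - Y) i 1 * w 1 0 = 0.
    by rewrite -mulmx2E mulmxBl Xw subrr zeromxE.
  move: Ev Ew; set e0 := (X - Y) i 0; set e1 := (X - Y) i 1 => Ev Ew.
  have [->|->] : j = 0 \/ j = 1.
  - by case: j => [[|[|//]] ?]; [left | right]; apply: val_inj.
  - apply: (mulIf d0); rewrite -/e0 mul0r.
    transitivity (w 1 0 * (e0 * v 0 0 + e1 * v 1 0) - v 1 0 * (e0 * w 0 0 + e1 * w 1 0)).
      by ring.
    by rewrite Ev Ew !mulr0 subrr.
  - apply: (mulIf d0); rewrite -/e1 mul0r.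
    transitivity (v 0 0 * (e0 * w 0 0 + e1 * w 1 0) - w 0 0 * (e0 * v 0 0 + e1 * v 1 0)).
      by ring.
    by rewrite Ev Ew !mulr0 subrr.
by apply/subr0_eq/matrixP => i j; rewrite zeromxE.
Qed.

(** Since [a] is its own inverse, it is a double eigenvalue of [X], so [X - a%:M] is nilpotent and
    kills [v]. Such matrices are multiples of a single [N], whose kernel and image are the line of
    [v]; [m] is the slope of this line. *)
Lemma parabolic_span v : v != 0 -> exists N, forall X a, a * a = 1 ->
  \det X = 1 -> X *m v = a *: v -> exists k, X = a%:M + k *: N.
Proof.
move=> /cV2_neq0[v0|v0].
- set m := v 1 0 / v 0 0; exists (mx22 (- m) 1 (- (m * m)) m) => X a aa dX Xv.
  have an0 : a != 0 by apply/eqP => a0; move/eqP: aa; rewrite a0 mul0r eq_sym oner_eq0.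
  have v1 : v 1 0 = m * v 0 0 by rewrite divfK.
  have := congr1 (fun u : 'cV_2 => u 0 0) Xv; have := congr1 (fun u : 'cV_2 => u 1 0) Xv.
  rewrite /= !mulmx2E !scalemxE v1 => E1 E0.
  have X00 : X 0 0 = a - X 0 1 * m by apply: (mulIf v0); apply: (lincomb 1 E0); ring.
  have X10 : X 1 0 = a * m - X 1 1 * m by apply: (mulIf v0); apply: (lincomb 1 E1); ring.
  have X11 : X 1 1 = a + X 0 1 * m.
    apply: (mulfI an0); move: dX; rewrite det2E X00 X10 => dX.
    apply: (lincomb 1 dX); rewrite mulrDr aa; ring.
  by exists (X 0 1); apply: mx2P; rewrite !mx2E ?X10 ?X00 ?X11; ring.
- set m := v 0 0 / v 1 0; exists (mx22 m (- (m * m)) 1 (- m)) => X a aa dX Xv.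
  have an0 : a != 0 by apply/eqP => a0; move/eqP: aa; rewrite a0 mul0r eq_sym oner_eq0.
  have v1 : v 0 0 = m * v 1 0 by rewrite divfK.
  have := congr1 (fun u : 'cV_2 => u 0 0) Xv; have := congr1 (fun u : 'cV_2 => u 1 0) Xv.
  rewrite /= !mulmx2E !scalemxE v1 => E1 E0.
  have X11 : X 1 1 = a - X 1 0 * m by apply: (mulIf v0); apply: (lincomb 1 E1); ring.
  have X01 : X 0 1 = a * m - X 0 0 * m by apply: (mulIf v0); apply: (lincomb 1 E0); ring.
  have X00 : X 0 0 = a + X 1 0 * m.
    apply: (mulfI an0); move: dX; rewrite det2E X11 X01 => dX.
    apply: (lincomb 1 dX); rewrite mulrDr aa; ring.
  by exists (X 1 0); apply: mx2P; rewrite !mx2E ?X01 ?X00 ?X11; ring.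
Qed.

Lemma eigenvalue2E A a : eigenvalue A a = (a * a - a * \tr A + \det A == 0).
Proof.
have -> : a * a - a * \tr A + \det A = \det (A - a%:M) by rewrite !mx2E; ring.
apply/eigenvalueP/det0P => -[u]; last first.
  move=> u0 /eqP; rewrite mulmxBr subr_eq0 mul_mx_scalar => /eqP.
  by exists u.
by move=> uA u0; exists u => //; rewrite mulmxBr mul_mx_scalar uA subrr.
Qed.

Lemma eigenvalue_pm1 A :
  eigenvalue A 1 /\ eigenvalue A (-1) <-> \tr A = 0 /\ \det A = -1.
Proof.
rewrite !eigenvalue2E; split=> [[/eqP E1 /eqP E2]|[-> ->]]; last first.
  by split; apply/eqP; ring.
have trA : \tr A = 0.
  apply: (@mulfI _ 2); first by rewrite pnatr_eq0.
  rewrite mulr0; apply: (lincomb 1 (etrans E2 (esym E1))); ring.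
by split => //; move: E1; rewrite trA => E1; apply: (lincomb 1 E1); ring.
Qed.

(** * Intertwiners of traceless matrices *)

Lemma scale_det_m1 M : \det M != 0 -> exists2 c, c != 0 & \det (c *: M) = -1.
Proof.
move=> dM; exists (sqrtC (- (\det M)^-1)).
  by rewrite sqrtC_eq0 oppr_eq0 invr_eq0.
by rewrite detZ sqrtCK mulNr mulVf.
Qed.

Lemma intertwiner_unit M M' : \det M = -1 -> \det M' = -1 ->
  (1%:M + M' *m M \in unitmx) || (1%:M - M' *m M \in unitmx).
Proof.
move=> dM dM'; rewrite !unitmxE !unitfE -negb_and; apply/negP.
have dMM : \det (M' *m M) = 1 by rewrite det_mulmx dM dM' mulrNN mulr1.
have det1D X : \det (1%:M + X) = 1 + \tr X + \det X by rewrite !mx2E; ring.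
have det1B X : \det (1%:M - X) = 1 - \tr X + \det X by rewrite !mx2E; ring.
rewrite det1D det1B dMM => /andP[/eqP E1 /eqP E2].
have := congr2 +%R E1 E2; set t := \tr _.
rewrite (_ : _ + _ = 4); last by ring.
by rewrite addr0 => /eqP; rewrite pnatr_eq0.
Qed.

Lemma intertwiner M M' : M *m M = 1%:M -> M' *m M' = 1%:M ->
  (1%:M + M' *m M) *m M = M' *m (1%:M + M' *m M) /\
  (1%:M - M' *m M) *m M = - M' *m (1%:M - M' *m M).
Proof.
move=> MM MM'; rewrite !(mulmxDl, mulmxDr, mulNmx, mulmxN).
rewrite -[M' *m M *m M]mulmxA MM !mulmxA MM' !(mulmx1, mul1mx) opprK.
by split; rewrite addrC // [RHS]addrC.
Qed.

(** Once [Q] is scaled to determinant -1, an intertwiner with diag(1, -1) provides [P]; the one that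
    intertwines up to sign accounts for the second value of [q]. *)
Lemma diagonalize_traceless Q : \tr Q = 0 -> \det Q != 0 ->
  exists2 P, P \in unitmx & exists2 q, q != 0 & P *m Q = mx22 q 0 0 (- q) *m P.
Proof.
move=> Q0 dQ; have [c c0 dcQ] := scale_det_m1 dQ.
have tcQ : \tr (c *: Q) = 0 by rewrite mxtraceZ Q0 mulr0.
pose D := mx22 (1 : F) 0 0 (- 1).
have tD : \tr D = 0 by rewrite !mx2E; ring.
have dD : \det D = -1 by rewrite !mx2E; ring.
have [I1 I2] := intertwiner (involution_traceless tcQ dcQ) (involution_traceless tD dD).
have mkZ q : q *: D = mx22 q 0 0 (- q) by apply: mx2P; rewrite !mx2E; ring.
case/orP: (intertwiner_unit dcQ dD) => Pu.
  exists (1%:M + D *m (c *: Q)) => //; exists c^-1; first by rewrite invr_eq0.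
  rewrite -mkZ -scalemxAl -I1 -[in RHS]scalemxAr scalerA mulVf // scale1r //.
exists (1%:M - D *m (c *: Q)) => //; exists (- c^-1); first by rewrite oppr_eq0 invr_eq0.
by rewrite -mkZ scaleNr -scalerN -scalemxAl -I2 -[in RHS]scalemxAr scalerA mulVf // scale1r.
Qed.

Lemma commute_mx22_diag q X : q != 0 ->
  X *m mx22 q 0 0 (- q) = mx22 q 0 0 (- q) *m X -> is_diag_mx X.
Proof.
move=> q0 /matrixP XD; have := XD 0 1; have := XD 1 0; rewrite !mx2E => E10 E01.
have q2 : 2 * q != 0 by rewrite mulf_neq0 // pnatr_eq0.
have X01 : X 0 1 = 0 by apply: (mulfI q2); apply: (lincomb (- 1) E01); ring.
have X10 : X 1 0 = 0 by apply: (mulfI q2); apply: (lincomb 1 E10); ring.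
have -> : X = diag_mx (\row_j X j j).
  by apply: mx2P; rewrite ?X01 ?X10 !mxE /= ?mulr1n ?mulr0n.
exact: diag_mx_is_diag.
Qed.

(** A matrix is traceless exactly when its adjugate is its opposite: apply this to [M] and to
    [M *m A]. If [\det A = 1], then [\adj A] is the inverse of [A]. *)
Lemma traceless_mul_adj M A : \tr M = 0 -> \tr (M *m A) = 0 -> M *m A = \adj A *m M.
Proof.
move=> M0 MA.
have -> : M *m A = (\tr (M *m A))%:M - \tr M *: \adj A + \adj A *m M.
  by rewrite adj2E; apply: mx2P; rewrite !mx2E; ring.
by rewrite M0 MA scale0r subr0 raddf0 add0r.
Qed.

Lemma traceless_adj_mul M A : \tr M = 0 -> \tr (M *m A) = 0 -> M *m \adj A = A *m M.
Proof.
move=> M0 MA.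
have -> : M *m \adj A = (\tr M * \tr A - \tr (M *m A))%:M - \tr M *: A + A *m M.
  by rewrite adj2E; apply: mx2P; rewrite !mx2E; ring.
by rewrite M0 MA scale0r mul0r !subr0 raddf0 add0r.
Qed.

Lemma traceless_intertwine_trace M A : \tr M = 0 -> M *m A = \adj A *m M ->
  \tr (M *m A) = 0.
Proof.
move=> M0 MA; apply/eqP; rewrite -(mulrI_eq0 _ (@mulfI _ 2 _)) ?pnatr_eq0 //.
rewrite mulr_natl mulr2n {1}MA adj2E mulmxBl mul_scalar_mx raddfB /= mxtraceZ M0 mulr0 sub0r.
by rewrite [\tr (A *m M)]mxtrace_mulC addNr.
Qed.

Lemma adj2M A B : \adj (A *m B) = \adj B *m \adj A.
Proof. by rewrite !adj2E; apply: mx2P; rewrite !mx2E; ring. Qed.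

Lemma adj2K A : \adj (\adj A) = A.
Proof. by rewrite !adj2E; apply: mx2P; rewrite !mx2E; ring. Qed.

(** The condition on [A5] follows from the other four: moving [M] across one word for [A5] replaces
    each factor by its adjugate, which gives the adjugate of the other word. *)
Lemma trace_orthogonal5 A1 A2 A3 A4 A5 :
    \det A1 = 1 -> \det A2 = 1 -> \det A3 = 1 -> \det A4 = 1 ->
    A5 = A4 *m \adj A3 *m A2 *m \adj A1 ->
    A5 = \adj A1 *m A2 *m \adj A3 *m A4 ->
  exists M, [/\ M != 0, \tr M = 0, \tr (M *m A1) = 0, \tr (M *m A2) = 0
              & [/\ \tr (M *m A3) = 0, \tr (M *m A4) = 0 & \tr (M *m A5) = 0]].
Proof.
move=> d1 d2 d3 d4 A5E A5E'.
have [M [M0 tM M1 M2 [M3 M4]]] := trace_orthogonal4 d1 d2 d3 d4 (etrans (esym A5E) A5E').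
exists M; split => //; split => //; apply: traceless_intertwine_trace => //.
rewrite {2}A5E' !adj2M !adj2K A5E !mulmxA (traceless_mul_adj tM M4).
rewrite -[_ *m M *m \adj A3]mulmxA (traceless_adj_mul tM M3) -!mulmxA.
rewrite [M *m (A2 *m _)]mulmxA (traceless_mul_adj tM M2) -mulmxA.
by rewrite (traceless_adj_mul tM M1).
Qed.

Lemma singular_kernel M : \det M = 0 -> exists2 u : 'cV[F]_2, u != 0 & M *m u = 0.
Proof.
rewrite -det_tr => /eqP/det0P[v v0 vM]; exists v^T.
  by rewrite -(inj_eq trmx_inj) trmxK trmx0.
by apply: trmx_inj; rewrite trmx_mul trmxK vM trmx0.
Qed.

Lemma scale_traceless_unit (I : Type) (A : I -> 'M[F]_2) M :
    \det M != 0 -> \tr M = 0 -> (forall i, \tr (M *m A i) = 0) ->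
  exists N, [/\ \tr N = 0, \det N = -1 & forall i, \tr (N *m A i) = 0].
Proof.
move=> dM tM MA; have [c _ dcM] := scale_det_m1 dM.
exists (c *: M); split => [|//|i]; first by rewrite mxtraceZ tM mulr0.
by rewrite -scalemxAl mxtraceZ MA mulr0.
Qed.

(** The family lies in the span of 1 and any of its non-scalar members. *)
Lemma commuting_traceless (I : Type) (A : I -> 'M[F]_2) :
    (forall i j, A i *m A j = A j *m A i) ->
  exists M, [/\ \det M != 0, \tr M = 0 & forall i, \tr (M *m A i) = 0].
Proof.
move=> AA; have [[j nsc]|sc] := pselect (exists j, ~ exists s, A j = s%:M).
  have [M [dM tM MA]] := traceless_nonisotropic (A j).
  exists M; split => // i; case: (commuting_span (AA j i)) => // -[x [c ->]].
  exact: trace_mulmx_span.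
have [M [dM tM _]] := traceless_nonisotropic (0 : 'M[F]_2).
exists M; split => // i; have [s ->] : exists s, A i = s%:M.
  by apply: contrapT => nsc; apply: sc; exists i.
exact: trace_mulmx_scalar.
Qed.

Lemma vspace_line (V : {vspace 'cV[F]_2}) : V <> 0%VS -> V <> fullv ->
  exists v, [/\ v != 0, v \in V & forall u, u \in V -> exists k, u = k *: v].
Proof.
move=> V0 Vf; have v0 : vpick V != 0 by rewrite vpick0; apply/eqP.
exists (vpick V); split => //; first exact: memv_pick.
have dV : (\dim V < 2)%N.
  rewrite ltnNge; apply/negP => dV; apply: Vf; apply/eqP.
  by rewrite eqEdim subvf dimvf /dim /= muln1.
have VE : (<[vpick V]> = V)%VS.
  apply/eqP; rewrite eqEdim -memvE memv_pick /= dim_vline v0.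
  by rewrite -ltnS.
by move=> u; rewrite -{1}VE => /vlineP.
Qed.

Lemma commute_common_eigenvectors (I : Type) (rho : I -> 'M[F]_2) (chi chi' : I -> F)
    (v w : 'cV[F]_2) : v != 0 -> w != 0 ->
    (forall x, rho x *m v = chi x *: v) -> (forall x, rho x *m w = chi' x *: w) ->
    (forall x, chi' x * chi x = 1) -> (forall x, \det (rho x) = 1) ->
  forall x y, rho x *m rho y = rho y *m rho x.
Proof.
move=> v0 w0 rv rw cc dr x y.
have [[k wE]|ind] := pselect (exists k, w = k *: v); last first.
  apply: (eq_on_basis v0 (w := w)) => [k||].
  - by apply/eqP => wE; apply: ind; exists k.
  - by rewrite -!mulmxA !rv -!scalemxAr !rv !scalerA mulrC.
  - by rewrite -!mulmxA !rw -!scalemxAr !rw !scalerA mulrC.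
(* If [w] is on the line of [v], the two characters agree and take the values 1 and -1, so that
   [parabolic_span] applies. *)
have chi2 z : chi z * chi z = 1.
  rewrite -{1}(_ : chi' z = chi z) //; have := rw z.
  rewrite wE -scalemxAr rv !scalerA mulrC => /eqP.
  rewrite -subr_eq0 -scalerBl scaler_eq0 (negPf v0) orbF subr_eq0 => /eqP.
  by move/mulIf => ->//; apply: contraNneq w0 => k0; rewrite wE k0 scale0r.
have [N NP] := parabolic_span v0.
have [k1 ->] := NP _ _ (chi2 x) (dr x) (rv x).
have [k2 ->] := NP _ _ (chi2 y) (dr y) (rv y).
by apply: mx2P; rewrite !mx2E; ring.
Qed.

Lemma intertwiner_alternative M M' : \tr M = 0 -> \det M = -1 ->
    \tr M' = 0 -> \det M' = -1 ->
  let Q := 1%:M + M' *m M in let Q' := 1%:M - M' *m M in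
  (Q \in unitmx /\ Q *m M = M' *m Q) \/ (Q' \in unitmx /\ Q' *m M = - M' *m Q').
Proof.
move=> tM dM tM' dM' Q Q'.
have [I1 I2] := intertwiner (involution_traceless tM dM) (involution_traceless tM' dM').
by case/orP: (intertwiner_unit dM dM') => ?; [left | right].
Qed.

Lemma anticommuting_traceless M Q : M *m M = 1%:M -> Q *m M = - M *m Q -> \tr Q = 0.
Proof.
move=> MM QM; apply: (@mulfI _ 2); first by rewrite pnatr_eq0.
rewrite mulr0 mulr_natl mulr2n -{1}[Q]mulmx1 -MM mulmxA QM mulNmx mulNmx raddfN /=.
by rewrite mxtrace_mulC mulmxA MM mul1mx addNr.
Qed.

Lemma is_diag_mx2P A : is_diag_mx A -> A 0 1 = 0 /\ A 1 0 = 0.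
Proof. by move/is_diag_mxP => dA; split; apply: dA. Qed.

(** In the first case [M] is antidiagonal and anticommutes with diag(1, -1). In the second,
    everything commutes with the [D x], and an invertible traceless [Q] orthogonal to [M] will
    do. *)
Lemma diag_anticommuting (I : Type) (D : I -> 'M[F]_2) M :
    \tr M = 0 -> (forall x, is_diag_mx (D x)) ->
    M 0 0 = 0 \/ (forall x, exists s, D x = s%:M) ->
  exists Q, [/\ Q \in unitmx, (forall x, Q *m D x = D x *m Q) & Q *m M = - M *m Q].
Proof.
move=> tM dD [M00|sD].
  have M11 : M 1 1 = 0 by move: tM; rewrite mxtrace2E M00 add0r.
  exists (mx22 1 0 0 (- 1)); split=> [|x|].
  - rewrite unitmxE unitfE !mx2E mulr0 subr0 mulrN1.
    by rewrite oppr_eq0 oner_neq0.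
  - by have [E1 E2] := is_diag_mx2P (dD x); apply: mx2P; rewrite !mx2E ?E1 ?E2; ring.
  - by apply: mx2P; rewrite !mx2E ?M00 ?M11; ring.
have [Q [dQ tQ QM]] := traceless_nonisotropic M; exists Q; split=> [|x|].
- by rewrite unitmxE unitfE.
- by have [s ->] := sD x; rewrite scalar_mxC.
- by rewrite (traceless_mul_adj tQ QM) adj2E tM raddf0 sub0r.
Qed.

Lemma traceless_mul_diag M A : \tr M = 0 -> M 0 0 != 0 -> is_diag_mx A ->
  \tr (M *m A) = 0 -> exists s, A = s%:M.
Proof.
move=> tM M00 /is_diag_mx2P[A01 A10] MA; exists (A 0 0).
have M11 : M 1 1 = - M 0 0 by apply/eqP; rewrite eq_sym eqr_oppLR -addr_eq0 -mxtrace2E tM.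
apply: mx2P; rewrite ?A01 ?A10 !mx2E //; apply: (mulfI M00).
by move: MA; rewrite !mx2E A01 A10 M11 => MA; apply: (lincomb (- 1) MA); ring.
Qed.

Lemma adj2_scalar s : \adj (s%:M : 'M[F]_2) = s%:M.
Proof. by rewrite adj2E; apply: mx2P; rewrite !mx2E; ring. Qed.

End TwoByTwo.

Arguments lincomb {F} k {a b x y}.

(** * Representations and presentations *)

Section GeneralLinearGroup.
Variables (K : comUnitRingType) (n : nat).

(** The universal property of [orbifold_presentation] ranges over [groupType], so invertible
    matrices are bundled into a group. *)
Definition glmx := {A : 'M[K]_n | A \in unitmx}.
HB.instance Definition _ := Choice.on glmx.

Definition mk_glmx (A : 'M[K]_n) (uA : A \in unitmx) : glmx :=
  exist (fun A => is_true (A \in unitmx)) A uA.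

Definition glmx_one : glmx := mk_glmx (unitmx1 K n).

Lemma glmx_inv_subproof (A : glmx) : invmx (val A) \in unitmx.
Proof. by rewrite unitmx_inv (valP A). Qed.
Definition glmx_inv (A : glmx) : glmx := mk_glmx (glmx_inv_subproof A).

Lemma glmx_mul_subproof (A B : glmx) : val A *m val B \in unitmx.
Proof. by rewrite unitmx_mul (valP A) (valP B). Qed.
Definition glmx_mul (A B : glmx) : glmx := mk_glmx (glmx_mul_subproof A B).

Lemma glmx_mulA : associative glmx_mul.
Proof. by move=> A B C; apply: val_inj; apply: mulmxA. Qed.
Lemma glmx_mul1mx : left_id glmx_one glmx_mul.
Proof. by move=> A; apply: val_inj; apply: mul1mx. Qed.
Lemma glmx_mulmx1 : right_id glmx_one glmx_mul.
Proof. by move=> A; apply: val_inj; apply: mulmx1. Qed.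
Lemma glmx_mulVmx : left_inverse glmx_one glmx_inv glmx_mul.
Proof. by move=> A; apply: val_inj; apply: mulVmx (valP A). Qed.
Lemma glmx_mulmxV : right_inverse glmx_one glmx_inv glmx_mul.
Proof. by move=> A; apply: val_inj; apply: mulmxV (valP A). Qed.

HB.instance Definition _ := isGroup.Build glmx
  glmx_mulA glmx_mul1mx glmx_mulmx1 glmx_mulVmx glmx_mulmxV.

Lemma val_glmxM (A B : glmx) : val (A * B)%g = val A *m val B.
Proof. by []. Qed.

Lemma val_glmx1 : val (1%g : glmx) = 1%:M.
Proof. by []. Qed.

End GeneralLinearGroup.

Section Representations.
Variables (R : realType) (G : groupType).
Local Notation M2 := 'M[R[i]]_2.
Implicit Types rho sigma tau : G -> M2.

Lemma rep1 rho : is_rep rho -> rho 1%g = 1%:M.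
Proof. by case. Qed.

Lemma repM rho x y : is_rep rho -> rho (x * y)%g = rho x *m rho y.
Proof. by case. Qed.

Lemma repV rho x : is_rep rho -> rho x^-1%g *m rho x = 1%:M.
Proof. by move=> rhoP; rewrite -repM // mulVg rep1. Qed.

Lemma rep_unit rho x : is_rep rho -> rho x \in unitmx.
Proof. by move=> rhoP; case: (mulmx1_unit (repV x rhoP)). Qed.

Lemma repV_adj rho x : HomSL2 rho -> rho x^-1%g = \adj (rho x).
Proof.
case=> rhoP rho1; rewrite -[LHS]mulmx1.
have <- : rho x *m \adj (rho x) = 1%:M by rewrite mul_mx_adj rho1.
by rewrite mulmxA repV // mul1mx.
Qed.

Lemma conjugateP rho sigma :
  conjugate rho sigma <-> exists2 P, P \in unitmx & forall x, P *m rho x = sigma x *m P.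
Proof.
split=> -[P Pu E]; exists P => // x.
  by rewrite E mulmxKV.
by rewrite E mulmxK.
Qed.

Lemma conjugate_refl rho : conjugate rho rho.
Proof.
by exists 1%:M; [exact: unitmx1 | move=> x; rewrite invmx1 mulmx1 mul1mx].
Qed.

Lemma conjugate_sym rho sigma : conjugate rho sigma -> conjugate sigma rho.
Proof.
case=> P Pu E; exists (invmx P); first by rewrite unitmx_inv.
by move=> x; rewrite E invmxK !mulmxA mulVmx // mul1mx mulmxKV.
Qed.

Lemma conjugate_trans rho sigma tau :
  conjugate rho sigma -> conjugate sigma tau -> conjugate rho tau.
Proof.
move=> /conjugateP[P Pu E] /conjugateP[Q Qu E']; apply/conjugateP.
exists (Q *m P); first by rewrite unitmx_mul Qu Pu.
by move=> x; rewrite -mulmxA E !mulmxA E'.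
Qed.

Lemma PGL2_class_eq rho sigma :
  PGL2_class rho = PGL2_class sigma <-> conjugate rho sigma.
Proof.
split=> [E|rs].
  have : PGL2_class sigma sigma by exact: conjugate_refl.
  by rewrite -E.
apply/seteqP; split=> tau /= h; last exact: conjugate_trans rs h.
exact: conjugate_trans (conjugate_sym rs) h.
Qed.

Lemma conjugate_rep rho sigma : is_rep rho -> conjugate rho sigma -> is_rep sigma.
Proof.
move=> rhoP [P Pu E]; split=> [|x y]; rewrite !E.
  by rewrite rep1 // mulmx1 mulmxV.
by rewrite repM // !mulmxA mulmxKV.
Qed.

End Representations.

Lemma conjugate_comp (R : realType) (G H : groupType) (f : G -> H)
    (rho sigma : H -> 'M[R[i]]_2) :
  conjugate rho sigma -> conjugate (rho \o f) (sigma \o f).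
Proof. by case=> P Pu E; exists P => // x; apply: E. Qed.

(** * Matrix representations of the orbifold group *)

Section Orbifold.
Variables (R : realType) (Gorb : groupType) (gamma : 'I_6 -> Gorb).
Hypothesis gammaP : orbifold_presentation gamma.
Local Notation M2 := 'M[R[i]]_2.

Lemma gamma_sqr i : (gamma i * gamma i = 1)%g.
Proof. by rewrite -expg2; apply: gammaP.1.1. Qed.

Lemma gamma_inv i : ((gamma i)^-1 = gamma i)%g.
Proof. by apply: (mulgI (gamma i)); rewrite mulgV gamma_sqr. Qed.

Lemma orbifold_rep_ext (sigma tau : Gorb -> M2) : is_rep sigma -> is_rep tau ->
  (forall i, sigma (gamma i) = tau (gamma i)) -> sigma = tau.
Proof.
move=> sP tP E.
pose f x : glmx _ 2 := mk_glmx (rep_unit x sP).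
pose g x : glmx _ 2 := mk_glmx (rep_unit x tP).
have fM : monoid.monoid_morphism f.
  by split=> [|x y]; apply: val_inj; [apply: rep1 | apply: repM].
have gM : monoid.monoid_morphism g.
  by split=> [|x y]; apply: val_inj; [apply: rep1 | apply: repM].
have rel : orbifold_relations (f \o gamma).
  case: gammaP => -[sq pr] _; split=> [i|] /=.
    by rewrite expgS expg1 -fM.2 -expg2 sq fM.1.
  by rewrite -(big_morph f fM.2 fM.1) pr fM.1.
have [h [_ h_uniq]] := gammaP.2 _ _ rel.
have hf : h = f by apply: h_uniq.
have hg : h = g by apply: h_uniq; split => // i; apply: val_inj; rewrite /= E.
by apply/funext => x; rewrite -[sigma x]/(val (f x)) -hf hg.
Qed.

Lemma orbifold_rep_exists (h : 'I_6 -> M2) : (forall i, h i *m h i = 1%:M) ->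
    \big[mulmx/1%:M]_(i < 6) h i = 1%:M ->
  exists2 sigma : Gorb -> M2, is_rep sigma & forall i, sigma (gamma i) = h i.
Proof.
move=> sq pr; have hu i : h i \in unitmx by case: (mulmx1_unit (sq i)).
pose h' i : glmx _ 2 := mk_glmx (hu i).
have rel : orbifold_relations h'.
  split=> [i|]; apply: val_inj; first exact: sq.
  by rewrite (big_morph val (@val_glmxM _ 2) (@val_glmx1 _ 2)).
have [f [[fM fh] _]] := gammaP.2 _ _ rel; exists (fun x => val (f x)).
  by split=> [|x y]; rewrite ?fM.1 ?fM.2.
by move=> i; rewrite fh.
Qed.

End Orbifold.

(** * Extending representations along the hyperelliptic cover *)

Section Cover.
Variables (R : realType) (Gorb : groupType) (gamma : 'I_6 -> Gorb).
Hypothesis gammaP : orbifold_presentation gamma.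
Variables (G : groupType) (pi : G -> Gorb).
Hypotheses (piM : monoid.monoid_morphism pi) (pi_inj : injective pi).
Hypothesis pi_im : range pi = even_words gamma.
Local Notation M2 := 'M[R[i]]_2.

(** * Generators and relations of the even subgroup *)

Lemma pair_lift :
  exists a : 'I_6 -> 'I_6 -> G, forall i j, pi (a i j) = (gamma i * gamma j)%g.
Proof.
have ex (ij : 'I_6 * 'I_6) : exists x, pi x = (gamma ij.1 * gamma ij.2)%g.
  have : even_words gamma (gamma ij.1 * gamma ij.2)%g.
    by exists [:: ij.1; ij.2] => //; rewrite !big_cons big_nil mulg1.
  by rewrite -pi_im => -[x _ <-]; exists x.
have [f fP] := choice ex.
by exists (fun i j => f (i, j)) => i j; rewrite fP.
Qed.

Variable a : 'I_6 -> 'I_6 -> G.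
Hypothesis aP : forall i j, pi (a i j) = (gamma i * gamma j)%g.

Lemma pair_mul i j k : (a i j * a j k)%g = a i k.
Proof.
by apply: pi_inj; rewrite piM.2 !aP mulgA -(mulgA (gamma i)) (gamma_sqr gammaP) mulg1.
Qed.

Lemma pair_id i : a i i = 1%g.
Proof. by apply: pi_inj; rewrite aP piM.1 (gamma_sqr gammaP). Qed.

Lemma pair_inv i j : ((a i j)^-1)%g = a j i.
Proof. by apply: (mulgI (a i j)); rewrite mulgV pair_mul pair_id. Qed.

(** Strong induction on the length of an even word for [pi x], whose letters are removed two at a
    time. *)
Lemma pair_ind (P : G -> Prop) : P 1%g -> (forall i j x, P x -> P (a i j * x)%g) ->
  forall x, P x.
Proof.
move=> P1 PM x; have : even_words gamma (pi x) by rewrite -pi_im; exists x.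
case=> s; have [n] := ubnP (size s); elim: n s x => // n IHn s x.
case: s => [|i [|j s]] //= sn es.
  by rewrite big_nil => pix; rewrite (_ : x = 1%g) //; apply: pi_inj; rewrite pix piM.1.
rewrite negbK in es; rewrite !big_cons mulgA -aP => pix.
rewrite -[x](mulVKg (a i j)); apply: PM; apply: (IHn s) => //.
  by move: sn; rewrite !ltnS => /ltnW.
by rewrite piM.2 pix pair_inv mulgA -piM.2 pair_mul pair_id piM.1 mul1g.
Qed.

(* Locked, since failed unifications would otherwise compute and compare the ordinals. *)
Local Notation o k := (locked (@inord 5) k%N).

Lemma prod6 (T : Type) (idx : T) (op : T -> T -> T) (h : 'I_6 -> T) :
  \big[op/idx]_(i < 6) h i =
  op (h (o 0)) (op (h (o 1)) (op (h (o 2)) (op (h (o 3)) (op (h (o 4)) (op (h (o 5)) idx))))).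
Proof.
rewrite !big_ord_recl big_ord0 -lock.
by do !congr (op _ _); congr h; apply: val_inj; rewrite /= inordK.
Qed.

Lemma ord6P (P : 'I_6 -> Prop) :
  P (o 0) -> P (o 1) -> P (o 2) -> P (o 3) -> P (o 4) -> P (o 5) -> forall i, P i.
Proof.
rewrite -lock => ? ? ? ? ? ?; by case=> [[|[|[|[|[|[|//]]]]]] lti];
  rewrite -[Ordinal lti]inord_val.
Qed.

Lemma pair_prod : (a (o 0) (o 1) * a (o 2) (o 3) * a (o 4) (o 5))%g = 1%g.
Proof.
apply: pi_inj; rewrite !piM.2 !aP piM.1; case: gammaP => -[_ <-] _.
by rewrite prod6 mulg1 !mulgA.
Qed.

(* The product relation, and its cyclic permutation starting at [gamma 1]. *)
Lemma pair_05_rel :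
  (a (o 0) (o 5) = a (o 0) (o 4) * a (o 3) (o 2) * a (o 1) (o 0))%g.
Proof.
rewrite -[LHS](pair_mul _ (o 4)) -mulgA; congr (_ * _)%g.
by apply: (mulgI (a (o 0) (o 1) * a (o 2) (o 3))%g);
  rewrite pair_prod !mulgA -(mulgA _ (a (o 2) (o 3))) pair_mul pair_id mulg1 pair_mul pair_id.
Qed.

Lemma pair_05_cyclic_rel : (a (o 0) (o 5) = a (o 1) (o 2) * a (o 3) (o 4))%g.
Proof.
apply: pi_inj; rewrite piM.2 !aP.
apply: (mulgI (gamma (o 0))); rewrite mulgA (gamma_sqr gammaP) mul1g.
apply: (mulIg (gamma (o 5))); rewrite (gamma_sqr gammaP).
by case: gammaP => -[_ <-] _; rewrite prod6 mulg1 !mulgA.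
Qed.

Lemma HomGL2_orbP (sigma : Gorb -> M2) : HomGL2_orb gamma sigma <->
  is_rep sigma /\ forall i, \tr (sigma (gamma i)) = 0 /\ \det (sigma (gamma i)) = -1.
Proof. by split=> -[? h]; split=> // i; apply/eigenvalue_pm1. Qed.

Lemma HomGL2_orb_conjugate (sigma tau : Gorb -> M2) :
  HomGL2_orb gamma sigma -> conjugate sigma tau -> HomGL2_orb gamma tau.
Proof.
move=> /HomGL2_orbP[sR sg] st; apply/HomGL2_orbP; split.
  exact: conjugate_rep sR st.
case: st => P Pu E i; have [t0 d1] := sg i; rewrite E; split.
  by rewrite mxtrace_mulC mulmxA mulVmx // mul1mx.
rewrite det_mulmx mulrC -det_mulmx mulmxA mulVmx // mul1mx; exact: d1.
Qed.

Lemma PhiTop_class (sigma : Gorb -> M2) :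
  PhiTop pi (PGL2_class sigma) = PGL2_class (sigma \o pi).
Proof.
apply/seteqP; split=> [tau [sigma' ss' st]|tau st].
  exact: conjugate_trans (conjugate_comp pi ss') st.
by exists sigma => //; exact: conjugate_refl.
Qed.

Lemma rep_pair (rho : G -> M2) i j : HomSL2 rho ->
  rho (a i j) = \adj (rho (a (o 0) i)) *m rho (a (o 0) j).
Proof. by move=> rhoP; rewrite -repV_adj // -(repM _ _ rhoP.1) pair_inv pair_mul. Qed.

(** * Lifts of a representation to the orbifold group *)

Section Lift.
Variable rho : G -> M2.
Hypothesis rhoP : HomSL2 rho.
Let rhoR : is_rep rho := rhoP.1.
Let rhoM x y : rho (x * y)%g = rho x *m rho y := repM x y rhoR.

Lemma lift_exists M : \tr M = 0 -> \det M = -1 ->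
    (forall i, \tr (M *m rho (a (o 0) i)) = 0) ->
  exists2 sigma, HomGL2_orb gamma sigma &
    sigma \o pi = rho /\ sigma (gamma (o 0)) = M.
Proof.
move=> M0 dM Ma; have rho1 := rhoP.2.
pose N i := M *m rho (a (o 0) i).
(* Since [gamma i] is [gamma (o 0)] times [pi (a (o 0) i)], a lift with value [M] at [gamma (o 0)]
   must take the value [N i] at [gamma i]. *)
have dN i : \det (N i) = -1 by rewrite det_mulmx dM rho1 mulr1.
have NN i : N i *m N i = 1%:M by exact: involution_traceless (Ma i) (dN i).
have NM i : N i *m M = rho (a i (o 0)).
  rewrite -[RHS]mul1mx -(NN i) {3}/N -!mulmxA -rhoM pair_mul pair_id rep1 //.
  by rewrite mulmx1.
have Nij i j : N i *m N j = rho (a i j).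
  by rewrite {2}/N mulmxA NM -rhoM pair_mul.
have Nprod : \big[mulmx/1%:M]_(i < 6) N i = 1%:M.
  rewrite prod6 mulmx1 (Nij (o 4)) [N (o 2) *m _]mulmxA (Nij (o 2)).
  rewrite [N (o 0) *m _]mulmxA (Nij (o 0)) -!rhoM mulgA.
  by rewrite pair_prod rep1.
have [sigma sigmaP sN] := orbifold_rep_exists gammaP NN Nprod.
exists sigma; first by apply/HomGL2_orbP; split => // i; rewrite sN; split; [exact: Ma | exact: dN].
split; last by rewrite sN /N pair_id rep1 // mulmx1.
apply/funext => x; elim/pair_ind: x => [|i j x IH] /=; first by rewrite piM.1 !rep1.
by rewrite piM.2 rhoM !(repM _ _ sigmaP) -IH /= aP (repM _ _ sigmaP) !sN Nij.
Qed.

Let A i := rho (a (o 0) i).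

Lemma invariant_traceless :
  exists M, [/\ M != 0, \tr M = 0 & forall i, \tr (M *m A i) = 0].
Proof.
have rhoA i j : rho (a i j) = \adj (A i) *m A j := rep_pair i j rhoP.
have dA i : \det (A i) = 1 by apply: rhoP.2.
have A0 : A (o 0) = 1%:M by rewrite /A pair_id rep1.
have adj1 : \adj (1%:M : M2) = 1%:M by rewrite -[LHS]mulmx1 mul_adj_mx det1.
(* The product relation and its cyclic permutation give two words for [A (o 5)] in the four other
   matrices. *)
have A5 : A (o 5) = A (o 4) *m \adj (A (o 3)) *m A (o 2) *m \adj (A (o 1)).
  rewrite {1}/A pair_05_rel !rhoM !rhoA A0 adj1.
  by rewrite mul1mx mulmx1 mulmxA.
have A5' : A (o 5) = \adj (A (o 1)) *m A (o 2) *m \adj (A (o 3)) *m A (o 4).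
  by rewrite {1}/A pair_05_cyclic_rel rhoM !rhoA mulmxA.
have [M [M0 tM M1 M2 [M3 M4 M5]]] :=
  trace_orthogonal5 (dA _) (dA _) (dA _) (dA _) A5 A5'.
have MA0 : \tr (M *m A (o 0)) = 0 by rewrite A0 mulmx1 tM.
exists M; split; [exact: M0 | exact: tM |].
exact: (ord6P (P := fun i => \tr (M *m A i) = 0) MA0 M1 M2 M3 M4 M5).
Qed.

(** A matrix conjugating [sigma \o pi] to [rho] also conjugates [sigma], so each preimage contains a
    representation restricting to [rho] on the nose. *)
Lemma preimage_lift c : PhiTop_preimages gamma pi rho c <->
  exists2 sigma, HomGL2_orb gamma sigma & sigma \o pi = rho /\ c = PGL2_class sigma.
Proof.
split=> [[[sigma sP <-]]|[sigma sP [E ->]]]; last first.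
  by split; [exists sigma | rewrite PhiTop_class E].
rewrite PhiTop_class => /PGL2_class_eq[P Pu E].
pose tau x := P *m sigma x *m invmx P.
have st : conjugate sigma tau by exists P.
exists tau; first exact: HomGL2_orb_conjugate sP st.
by split; [apply/funext => x; rewrite E | apply/PGL2_class_eq].
Qed.

Lemma lift_involution (sigma : Gorb -> M2) i : HomGL2_orb gamma sigma ->
  sigma (gamma i) *m sigma (gamma i) = 1%:M.
Proof. by case=> sR _; rewrite -(repM _ _ sR) (gamma_sqr gammaP) rep1. Qed.

Lemma lift_iota (i0 : 'I_6) (iota : G -> G)
    (iotaP : forall g, pi (iota g) = (gamma i0 * pi g * (gamma i0)^-1)%g)
    (sigma : Gorb -> M2) : HomGL2_orb gamma sigma -> sigma \o pi = rho ->
  PGL2_class (rho \o iota) = PGL2_class rho.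
Proof.
move=> sP E; apply/PGL2_class_eq/conjugate_sym/conjugateP.
have sR := sP.1; exists (sigma (gamma i0)); first exact: rep_unit.
move=> x; rewrite -E /= iotaP (gamma_inv gammaP) -!(repM _ _ sR).
by rewrite -!mulgA (gamma_sqr gammaP) mulg1.
Qed.

Lemma irreducible_traceless : irreducible_rep rho ->
  exists M, [/\ \det M != 0, \tr M = 0 & forall i, \tr (M *m rho (a (o 0) i)) = 0].
Proof.
move=> irr; have [M [M0 tM MA]] := invariant_traceless.
exists M; split; [|exact: tM|exact: MA].
apply/eqP => /singular_kernel[u u0 Mu].
(* Moving [M] across [\adj (A i) *m A j] turns it into [A i *m \adj (A j)], so the kernel of [M] is
   invariant. *)
have stab x : forall w : 'cV_2, M *m w = 0 -> M *m (rho x *m w) = 0.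
  elim/pair_ind: x => [w Mw|i j x IH w Mw]; first by rewrite rep1 // mul1mx.
  rewrite rhoM (rep_pair _ _ rhoP) -!mulmxA mulmxA.
  rewrite (traceless_adj_mul tM (MA i)) -mulmxA [M *m _]mulmxA.
  by rewrite (traceless_mul_adj tM (MA j)) -mulmxA IH // !mulmx0.
pose f := linfun (mulmx M : 'cV_2 -> 'cV_2).
have kerE w : (w \in lker f) = (M *m w == 0) by rewrite memv_ker lfunE.
have [|V0|Vf] := irr (lker f).
- by move=> x v; rewrite !kerE => /eqP/stab-> .
- by move/eqP: u0; apply; apply/eqP; rewrite -memv0 -V0 kerE Mu.
- case/eqP: M0; apply/matrixP => i j.
  have : delta_mx j 0 \in lker f by rewrite Vf memvf.
  by rewrite kerE -colE => /eqP/matrixP/(_ i 0); rewrite !mxE.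
Qed.

Lemma lift_of_irreducible_or_abelian : irreducible_rep rho \/ abelian_rep rho ->
  exists2 sigma, HomGL2_orb gamma sigma & sigma \o pi = rho.
Proof.
move=> irr_ab.
have [M [dM tM MA]] : exists M, [/\ \det M != 0, \tr M = 0
    & forall i, \tr (M *m rho (a (o 0) i)) = 0].
  case: irr_ab => [|ab]; first exact: irreducible_traceless.
  by apply: commuting_traceless => i j; apply: ab.
have [N [tN dN NA]] := scale_traceless_unit dM tM MA.
by have [sigma sP [E _]] := lift_exists tN dN NA; exists sigma.
Qed.

Lemma invariant_irreducible_or_abelian (i0 : 'I_6) (iota : G -> G)
    (iotaP : forall g, pi (iota g) = (gamma i0 * pi g * (gamma i0)^-1)%g) :
  PGL2_class (rho \o iota) = PGL2_class rho -> irreducible_rep rho \/ abelian_rep rho.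
Proof.
move=> /PGL2_class_eq/conjugate_sym/conjugateP[P Pu PE].
have [|red] := pselect (irreducible_rep rho); [by left | right].
move/existsNP: red => [V] /not_implyP[Vst] /not_orP[V0 Vf].
have [v [v0 vV lineV]] := vspace_line V0 Vf.
have [chi rv] := choice (fun x => lineV _ (Vst x v vV)).
(* As [P] intertwines [rho] with [rho \o iota], the vector [w] is a common eigenvector with
   character [chi \o iota]. *)
pose w := invmx P *m v.
have rw x : rho x *m w = chi (iota x) *: w.
  rewrite /w scalemxAr -rv /= !mulmxA; congr (_ *m _).
  rewrite -[rho x](mulKmx Pu) (PE x) /=.
  by rewrite !mulmxA mulmxK.
have w0 : w != 0.
  apply: contraNneq v0 => w0; by rewrite -(mulKVmx Pu v) -/w w0 mulmx0.
have chiM x y : chi (x * y)%g = chi x * chi y.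
  apply/eqP; rewrite -subr_eq0 -[_ == 0]orbF -(negPf v0) -scaler_eq0 scalerBl subr_eq0.
  by rewrite -rv rhoM -mulmxA rv -scalemxAr rv scalerA mulrC.
have chi1 : chi 1%g = 1.
  apply/eqP; rewrite -subr_eq0 -[_ == 0]orbF -(negPf v0) -scaler_eq0 scalerBl subr_eq0.
  by rewrite -rv rep1 // mul1mx scale1r.
have iota1 : iota 1%g = 1%g.
  by apply: pi_inj; rewrite iotaP piM.1 mulg1 mulgV.
have iotaM x y : iota (x * y)%g = (iota x * iota y)%g.
  by apply: pi_inj; rewrite piM.2 !iotaP piM.2 !mulgA mulgVK.
have iota_pair i j : iota (a i j) = (a i0 i * a j i0)%g.
  by apply: pi_inj; rewrite iotaP piM.2 !aP (gamma_inv gammaP) !mulgA.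
(* Swapping the factors of [iota (a i j)] gives the inverse of [a i j], and [chi] does not see the
   swap. *)
have chi_iota x : chi (iota x) * chi x = 1.
  elim/pair_ind: x => [|i j x IH]; first by rewrite iota1 chi1 mulr1.
  rewrite iotaM !chiM mulrACA IH mulr1.
  by rewrite iota_pair chiM [chi (a i0 i) * _]mulrC -!chiM !pair_mul pair_id.
exact: commute_common_eigenvectors v0 w0 rv rw chi_iota rhoP.2.
Qed.

(** * Counting the lifts *)

Lemma lift_gamma sigma i : HomGL2_orb gamma sigma -> sigma \o pi = rho ->
  sigma (gamma i) = sigma (gamma (o 0)) *m rho (a (o 0) i).
Proof.
move=> [sR _] E; rewrite -E /= aP -(repM _ _ sR) mulgA (gamma_sqr gammaP) mul1g.
by [].
Qed.

(** A lift is determined by [rho] and its value at [gamma (o 0)], so [Q] need only be tested on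
    these. *)
Lemma lift_conjugate sigma tau Q :
    HomGL2_orb gamma sigma -> sigma \o pi = rho ->
    HomGL2_orb gamma tau -> tau \o pi = rho ->
    Q \in unitmx -> (forall x, Q *m rho x = rho x *m Q) ->
    Q *m sigma (gamma (o 0)) = tau (gamma (o 0)) *m Q ->
  conjugate sigma tau.
Proof.
move=> sP sE tP tE Qu Qrho QM.
pose tau' x := Q *m sigma x *m invmx Q.
have st : conjugate sigma tau' by exists Q.
rewrite (_ : tau = tau') //; apply: (orbifold_rep_ext gammaP tP.1) => [|i].
  exact: conjugate_rep sP.1 st.
rewrite /tau' (lift_gamma i sP sE) (lift_gamma i tP tE).
by rewrite mulmxA QM -[_ *m Q *m rho _]mulmxA Qrho mulmxA mulmxK.
Qed.

(** Even words are stable under conjugation by every generator; the lifts are compared at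
    [gamma (o 0)], whatever index defines [iota]. *)
Lemma pi_conj_gamma i x : exists y, pi y = (gamma i * pi x * gamma i)%g.
Proof.
elim/pair_ind: x => [|j k x [y yE]].
  by exists 1%g; rewrite piM.1 mulg1 (gamma_sqr gammaP).
exists (a i j * a k i * y)%g; rewrite !piM.2 yE !aP !mulgA.
by rewrite -(mulgA (gamma i * gamma j * gamma k)%g) (gamma_sqr gammaP) mulg1.
Qed.

(** Both lifts send [gamma (o 0)] to an involution conjugating [rho x] to the same [rho y]. *)
Lemma lift_ratio_commute sigma tau x :
    HomGL2_orb gamma sigma -> sigma \o pi = rho ->
    HomGL2_orb gamma tau -> tau \o pi = rho ->
  let Z := tau (gamma (o 0)) *m sigma (gamma (o 0)) in Z *m rho x = rho x *m Z.
Proof.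
move=> sP sE tP tE /=; have [y yE] := pi_conj_gamma (o 0) x.
have E (u : Gorb -> M2) : HomGL2_orb gamma u -> u \o pi = rho ->
    u (gamma (o 0)) *m rho x *m u (gamma (o 0)) = rho y.
  by move=> [uR _] uE; rewrite -uE /= -!(repM _ _ uR) -yE.
have Es := E _ sP sE; have Et := E _ tP tE.
have ss := lift_involution (o 0) sP; have tt := lift_involution (o 0) tP.
rewrite -[LHS]mulmx1 -[in LHS]ss !mulmxA.
rewrite -[_ *m sigma _ *m rho x]mulmxA -[_ *m (sigma _ *m rho x) *m _]mulmxA Es -Et.
by rewrite !mulmxA tt mul1mx.
Qed.

(** This is the twist of [sigma] by the parity of word length, a character trivial on even words. *)
Lemma lift_neg sigma : HomGL2_orb gamma sigma -> sigma \o pi = rho ->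
  exists2 sigma', HomGL2_orb gamma sigma' &
    sigma' \o pi = rho /\ sigma' (gamma (o 0)) = - sigma (gamma (o 0)).
Proof.
move=> sP sE; have [_ sg] := (HomGL2_orbP sigma).1 sP.
apply: lift_exists.
- by rewrite raddfN /= (sg _).1 oppr0.
- by rewrite -scaleN1r detZ (sg _).2 expr2 mulrNN mulr1 mul1r.
- by move=> i; rewrite mulNmx -(lift_gamma i sP sE) raddfN /= (sg _).1 oppr0.
Qed.

Section Pair.
Variables sigma sigma' : Gorb -> M2.
Hypotheses (sP : HomGL2_orb gamma sigma) (sE : sigma \o pi = rho).
Hypotheses (sP' : HomGL2_orb gamma sigma') (sE' : sigma' \o pi = rho).
Hypothesis sN : sigma' (gamma (o 0)) = - sigma (gamma (o 0)).

Lemma lift_dichotomy tau : HomGL2_orb gamma tau -> tau \o pi = rho ->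
  conjugate sigma tau \/ conjugate sigma' tau.
Proof.
move=> tP tE; have [_ sg] := (HomGL2_orbP sigma).1 sP.
have [_ tg] := (HomGL2_orbP tau).1 tP.
have ZC x := lift_ratio_commute x sP sE tP tE.
have := intertwiner_alternative (sg (o 0)).1 (sg (o 0)).2 (tg (o 0)).1 (tg (o 0)).2.
case=> -[Qu QM]; [left | right].
  apply: (lift_conjugate sP sE tP tE Qu _ QM) => x.
  by rewrite mulmxDl mulmxDr mul1mx mulmx1 ZC.
apply: (lift_conjugate sP' sE' tP tE Qu) => [x|].
  by rewrite mulmxBl mulmxBr mul1mx mulmx1 ZC.
by rewrite sN mulmxN QM mulNmx opprK.
Qed.

(** The conjugating [Q] centralizes [rho] and anticommutes with [sigma (gamma (o 0))]. It is thus
    traceless and has two distinct eigenvalues, and a basis diagonalizing it diagonalizes [rho]. *)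
Lemma lift_neg_conjugate_diagonal : conjugate sigma sigma' -> diagonal_rep rho.
Proof.
move=> /conjugateP[Q Qu QE]; have [_ sg] := (HomGL2_orbP sigma).1 sP.
have Qrho x : Q *m rho x = rho x *m Q by rewrite -{1}sE -sE' /= QE.
have QM : Q *m sigma (gamma (o 0)) = - sigma (gamma (o 0)) *m Q by rewrite QE sN.
have tQ := anticommuting_traceless (lift_involution (o 0) sP) QM.
have dQ : \det Q != 0 by move: Qu; rewrite unitmxE unitfE.
have [P Pu [q q0 PQ]] := diagonalize_traceless tQ dQ.
exists (fun x => P *m rho x *m invmx P); first by exists P.
move=> x; apply: (commute_mx22_diag q0).
have DE : mx22 q 0 0 (- q) = P *m Q *m invmx P by rewrite PQ mulmxK.
by rewrite DE !mulmxA !mulmxKV // -[P *m rho x *m Q]mulmxA -Qrho mulmxA.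
Qed.

Lemma lift_neg_diagonal_conjugate : diagonal_rep rho -> conjugate sigma sigma'.
Proof.
case=> rho' [P Pu PE] dD; have [_ sg] := (HomGL2_orbP sigma).1 sP.
have [M ME] : exists M, M = P *m sigma (gamma (o 0)) *m invmx P by eexists.
have tM : \tr M = 0 by rewrite ME mxtrace_mulC mulmxA mulVmx // mul1mx (sg _).1.
have trM i : \tr (M *m rho' (a (o 0) i)) = 0.
  rewrite PE ME !mulmxA mulmxKV // mxtrace_mulC !mulmxA mulVmx // mul1mx.
  by rewrite -(lift_gamma i sP sE) (sg i).1.
have conjP X : P *m X = P *m X *m invmx P *m P by rewrite mulmxKV.
have conjV X : X *m invmx P = invmx P *m (P *m X *m invmx P).
  by rewrite !mulmxA mulVmx // mul1mx.
have rho'P : HomSL2 rho'.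
  split; first by apply: (conjugate_rep rhoR); exists P.
  move=> x; rewrite PE det_mulmx mulrC -det_mulmx mulmxA mulVmx // mul1mx.
  exact: rhoP.2.
(* If [M] has a nonzero diagonal, orthogonality makes each diagonal [rho' (a (o 0) i)] scalar, hence
   all of [rho']. *)
have M0D : M 0 0 = 0 \/ (forall x, exists s, rho' x = s%:M).
  have [|M00] := eqVneq (M 0 0) 0; [by left | right].
  have sc i := traceless_mul_diag tM M00 (dD (a (o 0) i)) (trM i).
  elim/pair_ind => [|i j x [s sx]]; first by exists 1; rewrite (rep1 rho'P.1).
  have [s1 E1] := sc i; have [s2 E2] := sc j; exists (s1 * s2 * s).
  rewrite (repM _ _ rho'P.1) (rep_pair _ _ rho'P) E1 E2 sx.
  by rewrite adj2_scalar -!scalar_mxM.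
have [Q [Qu QD QM]] := diag_anticommuting tM dD M0D.
apply: (lift_conjugate sP sE sP' sE' (Q := invmx P *m Q *m P)) => [|x|].
- by rewrite !unitmx_mul unitmx_inv Pu Qu.
- rewrite -[_ *m P *m rho x]mulmxA conjP -PE !mulmxA -[_ *m Q *m rho' x]mulmxA QD.
  by rewrite conjV -PE !mulmxA.
- rewrite -[_ *m P *m sigma _]mulmxA conjP -ME !mulmxA -[_ *m Q *m M]mulmxA QM sN.
  by rewrite !(mulNmx, mulmxN) conjV -ME !mulmxA.
Qed.

Lemma preimages_pair :
  PhiTop_preimages gamma pi rho = [set PGL2_class sigma; PGL2_class sigma'].
Proof.
apply/seteqP; split=> [c /preimage_lift[tau tP [tE ->]]|c].
  by case: (lift_dichotomy tP tE) => /PGL2_class_eq h; [left | right].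
by case=> ->; apply/preimage_lift; [exists sigma | exists sigma'].
Qed.

End Pair.

End Lift.
End Cover.

(** * The equivalence and the number of preimages *)

Lemma card_set2 (T : Type) (x y : T) : x <> y -> [set x; y] #= `I_2.
Proof.
move=> xy; pose f n := if n is 0 then x else y.
have -> : [set x; y] = f @` `I_2.
  apply/seteqP; split=> [z [->|->]|z [[|n] _ <-]]; [| |by left|by right].
    by exists 0%N.
  by exists 1%N.
apply: inj_card_eq => m n; rewrite !inE => m2 n2.
by case: m n m2 n2 => [|[|?]] [|[|?]] //= _ _ // /esym; move/xy.
Qed.

Theorem theorem2p1 (R : realType)
    (* pi_1^orb(X/iota), pi_1(X), and the monomorphism pi_* between them *)
    (Gorb : groupType) (gamma : 'I_6 -> Gorb)
    (gammaP : orbifold_presentation gamma)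
    (G : groupType) (pi_star : G -> Gorb)
    (pi_starM : monoid.monoid_morphism pi_star) (pi_star_inj : injective pi_star)
    (pi_star_im : range pi_star = even_words gamma)
    (* a representative of the outer automorphism of pi_1(X) given by iota *)
    (i0 : 'I_6) (iota : G -> G)
    (iotaP : forall g, pi_star (iota g) = (gamma i0 * pi_star g * (gamma i0)^-1)%g)
    (rho : G -> 'M[R[i]]_2) (rhoP : HomSL2 rho) :
  [<-> irreducible_rep rho \/ abelian_rep rho;
       PGL2_class (rho \o iota) = PGL2_class rho;
       (PhiTop pi_star @` mod_PGL2 (HomGL2_orb (R := R) gamma)) (PGL2_class rho)]
  /\ (PGL2_class (rho \o iota) = PGL2_class rho ->
      (diagonal_rep rho -> PhiTop_preimages gamma pi_star rho #= `I_1) /\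
      (~ diagonal_rep rho -> PhiTop_preimages gamma pi_star rho #= `I_2)).
Proof.
have [a aP] := pair_lift pi_star_im.
have bP : PGL2_class (rho \o iota) = PGL2_class rho ->
    exists2 sigma, HomGL2_orb gamma sigma & sigma \o pi_star = rho.
  move/(invariant_irreducible_or_abelian gammaP pi_starM pi_star_inj pi_star_im aP rhoP iotaP).
  exact: (lift_of_irreducible_or_abelian gammaP pi_starM pi_star_inj pi_star_im aP rhoP).
split.
  tfae.
  - move/(lift_of_irreducible_or_abelian gammaP pi_starM pi_star_inj pi_star_im aP rhoP).
    move=> [sigma sP sE]; exact: (lift_iota gammaP iotaP sP sE).
  - case/bP=> sigma sP sE; exists (PGL2_class sigma); first by exists sigma.
    by rewrite PhiTop_class sE.
  - case=> c cP cE; have [sigma sP [sE _]] := (preimage_lift gamma pi_star rho c).1 (conj cP cE).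
    apply: (invariant_irreducible_or_abelian gammaP pi_starM pi_star_inj pi_star_im aP rhoP iotaP).
    exact: (lift_iota gammaP iotaP sP sE).
case/bP=> sigma sP sE.
have [sigma' sP' [sE' sN]] := lift_neg gammaP pi_starM pi_star_inj pi_star_im aP rhoP sP sE.
rewrite (preimages_pair gammaP pi_starM pi_star_inj pi_star_im aP sP sE sP' sE' sN).
split=> [diag|ndiag].
  have /PGL2_class_eq -> :=
    lift_neg_diagonal_conjugate gammaP pi_starM pi_star_inj pi_star_im aP rhoP sP sE sP' sE' sN diag.
  by rewrite setUid; apply: card_set1.
apply: card_set2 => /PGL2_class_eq.
by move/(lift_neg_conjugate_diagonal gammaP sP sE sE' sN).
Qed.
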